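(* Let $\mathscr{A}\in\mathbb{R}^{n\times n\times p}$ be non-singular, let $\mathscr{B}\in\mathbb{R}^{n\times1\times p}$, and let $\mathscr{X}^*$ be the unique solution of $\mathscr{A}^T*\mathscr{A}*\mathscr{X}=\mathscr{A}^T*\mathscr{B}$. Let $\mathscr{X}_k\in\mathbb{R}^{n\times1\times p}$ denote the $k$-th approximate solution obtained by the tubular steepest descent iteration $$\mathscr{X}_{k+1}=\mathscr{X}_k+\mathscr{D}_k*\|\mathscr{D}_k\|^2*\left(\|\mathscr{A}*\mathscr{D}_k\|^2\right)^{-1},\qquad \mathscr{D}_k=\mathscr{A}^T*(\mathscr{B}-\mathscr{A}*\mathscr{X}_k),\qquad k=0,1,2,\ldots$$ (where the tubular tensors $\|\mathscr{A}*\mathscr{D}_k\|^2$ are non-singular, so that the iteration is defined), and put $\mathscr{E}_k=\mathscr{X}^*-\mathscr{X}_k$. Then $$\langle\mathscr{A}*\mathscr{E}_{k+1},\mathscr{A}*\mathscr{E}_{k+1}\rangle\preceq[w]*\langle\mathscr{A}*\mathscr{E}_k,\mathscr{A}*\mathscr{E}_k\rangle,$$ where $[w]=([\kappa]-[e_1])^{2}*([\kappa]+[e_1])^{-2}$ and $[\kappa]=[\lambda_M(\mathscr{A}^T*\mathscr{A})]*[\lambda_m(\mathscr{A}^T*\mathscr{A})]^{-1}$.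
   Context: For a tensor $\mathscr{X}\in\mathbb{C}^{n\times m\times p}$, $X_k\in\mathbb{C}^{n\times m}$ denotes the $k$-th frontal slice. $\mathrm{Unfold}(\mathscr{X})\in\mathbb{C}^{np\times m}$ stacks $X_1,\dots,X_p$ vertically, and $\mathrm{Fold}$ is its inverse. $\mathrm{bcirc}(\mathscr{X})\in\mathbb{C}^{np\times mp}$ is the block-circulant matrix whose $(i,j)$ block is $X_{((i-j)\bmod p)+1}$. The T-product is $\mathscr{X}*\mathscr{Y}=\mathrm{Fold}(\mathrm{bcirc}(\mathscr{X})\,\mathrm{Unfold}(\mathscr{Y}))$. The transpose/conjugate transpose are the tensors with $\mathrm{bcirc}(\mathscr{X}^T)=\mathrm{bcirc}(\mathscr{X})^T$, $\mathrm{bcirc}(\mathscr{X}^H)=\mathrm{bcirc}(\mathscr{X})^H$; $\mathscr{A}$ is Hermitian if $\mathscr{A}^H=\mathscr{A}$. A tubular tensor of length $p$ is a $1\times1\times p$ tensor; $[v]$ is the one with $[v]_{11j}=v_j$, and $\mathrm{circ}([v])$ is the circulant matrix with $(i,j)$ entry $v_{((i-j)\bmod p)+1}$. $e_1=(1,0,\dots,0)^T\in\mathbb{C}^p$, so $[e_1]$ is the identity tubular tensor. A tensor is non-singular if its $\mathrm{bcirc}$ is non-singular (equivalently it is invertible for $*$). Powers are with respect to $*$: $[a]^2=[a]*[a]$, $[a]^{-2}=([a]^{-1})^2$. Bilinear form and tubular norm: for $\mathscr{X},\mathscr{Y}\in\mathbb{C}^{n\times1\times p}$, $\langle\mathscr{X},\mathscr{Y}\rangle=\mathscr{X}^H*\mathscr{Y}$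 (a tubular tensor), and $\|\mathscr{X}\|^2=\langle\mathscr{X},\mathscr{X}\rangle$. Order: $\mathscr{A}\in\mathbb{C}^{n\times n\times p}$ is positive semidefinite if the first frontal slice of $\mathscr{X}^H*\mathscr{A}*\mathscr{X}$ (a scalar) is $\ge0$ for all nonzero $\mathscr{X}\in\mathbb{C}^{n\times1\times p}$. For Hermitian $\mathscr{A},\mathscr{B}$ (in particular tubular tensors), $\mathscr{A}\preceq\mathscr{B}$ means $\mathscr{B}-\mathscr{A}$ is positive semidefinite. Extreme tubular eigenvalues: let $F_p$ be the unitary DFT matrix with entries $p^{-1/2}\omega^{(j-1)(k-1)}$, $\omega=e^{-2\pi\mathbf{i}/p}$. For a Hermitian tensor $\mathscr{H}\in\mathbb{C}^{n\times n\times p}$ write $\mathrm{bcirc}(\mathscr{H})=(F_p\otimes I_n)\,\mathrm{blockdiag}(\tilde H_1,\dots,\tilde H_p)(F_p^H\otimes I_n)$ with Hermitian $\tilde H_i\in\mathbb{C}^{n\times n}$. Then $[\lambda_m(\mathscr{H})]$ and $[\lambda_M(\mathscr{H})]$ are the tubular tensors with $F_p^H\mathrm{circ}([\lambda_m(\mathscr{H})])F_p=\mathrm{diag}(\lambda_{\min}(\tilde H_1),\dots,\lambda_{\min}(\tilde H_p))$ and $F_p^H\mathrm{circ}([\lambda_M(\mathscr{H})])F_p=\mathrm{diag}(\lambda_{\max}(\tilde H_1),\dots,\lambda_{\max}(\tilde H_p))$. *)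

(* Defs.v *)
From HB Require Import structures.
From mathcomp Require Import all_boot all_order all_algebra.
From mathcomp Require Import spectral complex.
From mathcomp Require Import all_classical all_reals all_analysis.

Set Implicit Arguments.
Unset Strict Implicit.
Unset Printing Implicit Defensive.

Import Order.TTheory GRing.Theory Num.Theory.
Local Open Scope classical_set_scope.
Local Open Scope ring_scope.
Local Open Scope complex_scope.

(* An n x m x p tensor is the family of its frontal slices; slices are numbered
   from 0. The number of slices is always of the form p.+1, so that 'I_p.+1
   carries its canonical additive group structure and subtraction of slice
   indices is subtraction modulo p.+1. Addition, subtraction and zero of
   tensors are those of finite functions. *)
Notation tensor K n m p := {ffun 'I_p -> 'M[K]_(n, m)}.

Section TProduct.
Context {K : numClosedFieldType} {p : nat}.

Definition tunfold n m (X : tensor K n m p.+1) : 'M[K]_(\sum_(k < p.+1) n, m) :=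
  \mxcol_(k < p.+1) X k.

Definition tfold n m (M : 'M[K]_(\sum_(k < p.+1) n, m)) : tensor K n m p.+1 :=
  [ffun k => submxcol M k].

Definition bcirc n m (X : tensor K n m p.+1) :
    'M[K]_(\sum_(i < p.+1) n, \sum_(j < p.+1) m) :=
  \mxblock_(i < p.+1, j < p.+1) X (i - j).

Definition tmul n m q (X : tensor K n m p.+1) (Y : tensor K m q p.+1) :
    tensor K n q p.+1 :=
  tfold (bcirc X *m tunfold Y).

(* See [bcirc_ttr] and [bcirc_therm] for the characterisations by bcirc. *)
Definition ttr n m (X : tensor K n m p.+1) : tensor K m n p.+1 :=
  [ffun k => (X (- k))^T].

Definition therm n m (X : tensor K n m p.+1) : tensor K m n p.+1 :=
  [ffun k => map_mx Num.conj (X (- k))^T].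

Definition thermitian n (A : tensor K n n p.+1) : Prop := therm A = A.

Definition tnonsingular n (A : tensor K n n p.+1) : bool := bcirc A \in unitmx.

Definition treal n m (X : tensor K n m p.+1) : Prop :=
  forall k, X k \is a mxOver Num.real.

(* Tubular tensors are those of type [tensor K 1 1 p.+1]. *)

Definition tube (v : 'cV[K]_p.+1) : tensor K 1 1 p.+1 :=
  [ffun k => (v k 0)%:M].

Definition tube_e1 : tensor K 1 1 p.+1 := tube (delta_mx ord0 0).

Definition circ (a : tensor K 1 1 p.+1) : 'M[K]_p.+1 :=
  \matrix_(i, j) a (i - j) 0 0.

(* The solution z of a * z = [e_1]; meaningful for non-singular a, see
   [tmul_tinv]. *)
Definition tinv (a : tensor K 1 1 p.+1) : tensor K 1 1 p.+1 :=
  tfold (invmx (bcirc a) *m tunfold tube_e1).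

Definition tdot n (X Y : tensor K n 1 p.+1) : tensor K 1 1 p.+1 :=
  tmul (therm X) Y.

Definition tnorm2 n (X : tensor K n 1 p.+1) : tensor K 1 1 p.+1 := tdot X X.

(* In a numClosedFieldType, 0 <= x says that x is real and nonnegative. *)
Definition tpsd n (A : tensor K n n p.+1) : Prop :=
  forall X : tensor K n 1 p.+1, X != 0 ->
    0 <= (tmul (tmul (therm X) A) X) ord0 0 0.

(* The Loewner order is a relation between Hermitian tensors. *)
Definition tle n (A B : tensor K n n p.+1) : Prop :=
  [/\ thermitian A, thermitian B & tpsd (B - A)].

Definition sd_dir n (A : tensor K n n p.+1) (B X : tensor K n 1 p.+1) :
    tensor K n 1 p.+1 :=
  tmul (ttr A) (B - tmul A X).

Definition sd_step n (A : tensor K n n p.+1) (B X : tensor K n 1 p.+1) :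
    tensor K n 1 p.+1 :=
  let D := sd_dir A B X in
  X + tmul (tmul D (tnorm2 D)) (tinv (tnorm2 (tmul A D))).

Lemma bcirc_ttr n m (X : tensor K n m p.+1) : bcirc (ttr X) = (bcirc X)^T.
Proof.
by rewrite tr_mxblock; apply: eq_mxblock => i j; rewrite ffunE opprB.
Qed.

Lemma bcirc_therm n m (X : tensor K n m p.+1) :
  bcirc (therm X) = map_mx Num.conj (bcirc X)^T.
Proof.
rewrite tr_mxblock; apply/matrixP => i j; rewrite !mxE.
by rewrite ffunE opprB !mxE.
Qed.

Lemma tmul_tinv (a : tensor K 1 1 p.+1) :
  tnonsingular a -> tmul a (tinv a) = tube_e1.
Proof.
move=> a_ns; rewrite /tmul /tinv /tunfold.
have -> : \mxcol_k tfold (invmx (bcirc a) *m tunfold tube_e1) k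
        = invmx (bcirc a) *m tunfold tube_e1.
  by rewrite -[RHS]submxcolK; apply: eq_mxcol => k; rewrite ffunE.
by rewrite mulKVmx //; apply/ffunP => k; rewrite ffunE mxcolK.
Qed.

(* Extreme eigenvalues of a square matrix. For a Hermitian matrix of positive
   size they exist and are unique, and the default value 0 is not used. *)
Definition lambda_min n (M : 'M[K]_n) : K :=
  xget 0 [set l | eigenvalue M l /\ forall mu, eigenvalue M mu -> l <= mu].

Definition lambda_max n (M : 'M[K]_n) : K :=
  xget 0 [set l | eigenvalue M l /\ forall mu, eigenvalue M mu -> mu <= l].

End TProduct.

Section Fourier.
Context {R : realType} {p : nat}.

(* exp (- 2 pi i / (p + 1)) *)
Definition dft_root : R[i] :=
  cos (2 * pi / p.+1%:R) -i* sin (2 * pi / p.+1%:R).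

Definition dft : 'M[R[i]]_p.+1 :=
  \matrix_(j, k) (((Num.sqrt p.+1%:R)^-1)%:C * dft_root ^+ (j * k)).

Definition dftH : 'M[R[i]]_p.+1 := map_mx Num.conj dft^T.

(* The Kronecker product of F with the identity matrix of size n *)
Definition kronI n (F : 'M[R[i]]_p.+1) :
    'M[R[i]]_(\sum_(i < p.+1) n, \sum_(j < p.+1) n) :=
  \mxblock_(i < p.+1, j < p.+1) ((F i j)%:M : 'M[R[i]]_n).

(* The (unique) diagonal blocks of the Fourier block-diagonalisation of
   bcirc H *)
Definition dft_blocks n (H : tensor R[i] n n p.+1) : {ffun 'I_p.+1 -> 'M[R[i]]_n} :=
  xget 0 [set D : {ffun 'I_p.+1 -> 'M[R[i]]_n} |
    bcirc H = kronI n dft *m (\mxdiag_(i < p.+1) D i) *m kronI n dftH].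

Definition tlambda_min n (H : tensor R[i] n n p.+1) : tensor R[i] 1 1 p.+1 :=
  xget 0 [set l : tensor R[i] 1 1 p.+1 | dftH *m circ l *m dft
    = diag_mx (\row_(i < p.+1) lambda_min (dft_blocks H i))].

Definition tlambda_max n (H : tensor R[i] n n p.+1) : tensor R[i] 1 1 p.+1 :=
  xget 0 [set l : tensor R[i] 1 1 p.+1 | dftH *m circ l *m dft
    = diag_mx (\row_(i < p.+1) lambda_max (dft_blocks H i))].

Definition tkappa n (H : tensor R[i] n n p.+1) : tensor R[i] 1 1 p.+1 :=
  tmul (tlambda_max H) (tinv (tlambda_min H)).

(* ([kappa] - [e_1])^2 * ([kappa] + [e_1])^-2 *)
Definition sd_rate (kappa : tensor R[i] 1 1 p.+1) : tensor R[i] 1 1 p.+1 :=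
  let a := kappa - tube_e1 in
  let b := tinv (kappa + tube_e1) in
  tmul (tmul a a) (tmul b b).

End Fourier.

(* Main.v *)
Require Import Defs.
From mathcomp Require Import all_boot all_order all_algebra.
From mathcomp Require Import ring lra spectral sesquilinear.
From mathcomp Require Import complex all_classical all_reals all_analysis.

(** The discrete Fourier transform along the third index turns the T-product
    into a slicewise matrix product, the tensor transpose of a real tensor into
    the slicewise conjugate transpose, and the order on Hermitian tubular tensors
    into the slicewise order of real numbers ([tft_mul], [tft_herm],
    [ttr_real], [tle_tube]).  It also block-diagonalises [bcirc], so the tubular extreme
    eigenvalues have the extreme eigenvalues of the Fourier slices as Fourier
    coefficients ([ttft_lambda_min], [ttft_lambda_max]).  One tubular
    steepest descent step is therefore an ordinary steepest descent step in
    each Fourier slice, with an exact line search for the positive definite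
    matrix M = P^H P, where P is the Fourier slice of A.

    In one slice, with error e and direction d = M e, the energy |P e|^2 drops
    by exactly |d|^4 / |P d|^2.  In an orthonormal eigenbasis of M, with
    eigenvalues s_i and u_i = s_i |y_i|^2 for the coordinates y_i of e, the
    claimed contraction, whose factor is 1 - 4 l L / (l + L)^2 for the extreme
    eigenvalues l and L, becomes the Kantorovich inequality
    4 l L (sum u_i) (sum s_i^2 u_i) <= (l + L)^2 (sum s_i u_i)^2
    ([kantorovich_sum], [sd_contraction]).  It follows from
    (s_i - l) (L - s_i) >= 0 and the arithmetic-geometric mean inequality. *)

Set Implicit Arguments.
Unset Strict Implicit.
Unset Printing Implicit Defensive.

Import Order.TTheory GRing.Theory Num.Theory.
Local Open Scope ring_scope.

(** * The Fourier transform of a tensor along its frontal slices *)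

Section TensorFourier.
Context {C : numClosedFieldType} {p : nat} (w : C).
Hypothesis w_prim : (p.+1).-primitive_root w.

Local Notation N := (p.+1%:R : C).

(** The unnormalised Fourier transform, for an arbitrary primitive root of
    unity w: slice i is sum_k w^(- i k) X_k.  For w = [dft_root] these slices
    are the diagonal blocks in the Fourier block-diagonalisation of [bcirc X]. *)
Definition tft n m (X : tensor C n m p.+1) : tensor C n m p.+1 :=
  [ffun i : 'I_p.+1 => \sum_(k < p.+1) (w ^- (i * k)) *: X k].

(** The inverse transform, which carries the factor 1 / (p + 1). *)
Definition itft n m (D : tensor C n m p.+1) : tensor C n m p.+1 :=
  [ffun k : 'I_p.+1 => N^-1 *: \sum_(i < p.+1) (w ^+ (i * k)) *: D i].

Lemma wpow_neq0 k : w ^+ k != 0.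
Proof. by rewrite expf_neq0 // (prim_root_eq0 w_prim). Qed.

Lemma conj_wpow k : (w ^+ k)^* = w ^- k.
Proof.
have nw : `|w| = 1.
  apply/eqP; rewrite -(@pexpr_eq1 _ _ p.+1) // -normrX.
  by rewrite prim_expr_order ?normr1.
by rewrite rmorphXn invC_norm normrX nw expr1n expr1n invr1 mul1r rmorphXn.
Qed.

(** The index k + l on the left is a sum modulo p + 1. *)
Lemma wpowD (i k l : 'I_p.+1) : w ^+ (i * (k + l)%R) = w ^+ (i * k) * w ^+ (i * l).
Proof.
rewrite -exprD -mulnDr mulnC exprM -(prim_expr_mod w_prim (k + l)%R) /=.
by rewrite modn_mod prim_expr_mod // -exprM mulnC.
Qed.

Lemma wpow0 (i : 'I_p.+1) : w ^+ (i * (0%R : 'I_p.+1)) = 1.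
Proof. by rewrite muln0. Qed.

Lemma wpowN (i k : 'I_p.+1) : w ^+ (i * (- k)%R) = w ^- (i * k).
Proof.
by apply: (mulIf (wpow_neq0 (i * k))); rewrite -wpowD addNr wpow0 mulVf ?wpow_neq0.
Qed.

Lemma wpowB (i k l : 'I_p.+1) : w ^+ (i * (k - l)%R) = w ^+ (i * k) / w ^+ (i * l).
Proof. by rewrite wpowD wpowN. Qed.

Lemma wpow_sum (k : 'I_p.+1) : \sum_(i < p.+1) w ^+ (i * k) = N *+ (k == 0).
Proof.
have [->|k0] := eqVneq k 0.
  by under eq_bigr do rewrite muln0; rewrite sumr_const card_ord.
have wk1 : w ^+ k - 1 != 0.
  rewrite subr_eq0 -(prim_order_dvd w_prim) gtnNdvd //.
  by rewrite lt0n; apply: contra k0 => /eqP k0; apply/eqP/val_inj.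
apply: (mulfI wk1); rewrite mulr0n mulr0.
under eq_bigr do rewrite mulnC exprM.
by rewrite -subrX1 -exprM mulnC exprM (prim_expr_order w_prim) expr1n subrr.
Qed.

Lemma wpow_orth (k l : 'I_p.+1) :
  \sum_(i < p.+1) w ^+ (i * k) / w ^+ (i * l) = N *+ (k == l).
Proof.
by under eq_bigr do rewrite -wpowB; rewrite wpow_sum subr_eq0.
Qed.

Lemma N_neq0 : N != 0. Proof. by rewrite pnatr_eq0. Qed.

Lemma tftK n m : cancel (@tft n m) (@itft n m).
Proof.
move=> X; apply/ffunP => k; rewrite !ffunE.
under eq_bigr => i _.
  rewrite ffunE scaler_sumr; under eq_bigr do rewrite scalerA; over.
rewrite exchange_big /=; under eq_bigr do rewrite -scaler_suml wpow_orth.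
rewrite (bigD1 k) //= eqxx big1 ?addr0 => [|l lk].
  by rewrite scalerA mulVf ?N_neq0 ?scale1r.
by rewrite eq_sym (negbTE lk) scale0r.
Qed.

Lemma itftK n m : cancel (@itft n m) (@tft n m).
Proof.
move=> D; apply/ffunP => i; rewrite !ffunE.
under eq_bigr => k _.
  rewrite ffunE scalerA mulrC -scalerA scaler_sumr.
  under eq_bigr do rewrite scalerA mulrC [(_ * k)%N]mulnC [(i * k)%N]mulnC; over.
rewrite -scaler_sumr exchange_big /=.
under eq_bigr do rewrite -scaler_suml wpow_orth.
rewrite (bigD1 i) //= eqxx big1 ?addr0 => [|l lk].
  by rewrite scalerA mulVf ?N_neq0 ?scale1r.
by rewrite (negbTE lk) scale0r.
Qed.

Lemma tft_inj n m : injective (@tft n m).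
Proof. exact: can_inj (@tftK n m). Qed.

Lemma tftD n m (X Y : tensor C n m p.+1) i : tft (X + Y) i = tft X i + tft Y i.
Proof.
by rewrite !ffunE -big_split; apply: eq_bigr => k _; rewrite ffunE scalerDr.
Qed.

Lemma tft0 n m i : tft (0 : tensor C n m p.+1) i = 0.
Proof. by rewrite ffunE big1 // => k _; rewrite ffunE scaler0. Qed.

Lemma tftN n m (X : tensor C n m p.+1) i : tft (- X) i = - tft X i.
Proof.
by rewrite !ffunE -sumrN; apply: eq_bigr => k _; rewrite ffunE scalerN.
Qed.

Lemma tftB n m (X Y : tensor C n m p.+1) i : tft (X - Y) i = tft X i - tft Y i.
Proof. by rewrite tftD tftN. Qed.

Lemma tmulE n m q (X : tensor C n m p.+1) (Y : tensor C m q p.+1) k :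
  tmul X Y k = \sum_j X (k - j) *m Y j.
Proof.
rewrite /tmul ffunE /bcirc /tunfold mxblockEh mul_mxrow_mxcol.
under eq_bigr do rewrite mxcol_mul.
by rewrite -mxcol_sum mxcolK.
Qed.

(** The convolution theorem. *)
Lemma tft_mul n m q (X : tensor C n m p.+1) (Y : tensor C m q p.+1) i :
  tft (tmul X Y) i = tft X i *m tft Y i.
Proof.
rewrite !ffunE mulmx_suml.
under eq_bigr do rewrite tmulE scaler_sumr.
rewrite exchange_big /=.
under [RHS]eq_bigr do rewrite mulmx_sumr.
rewrite [RHS]exchange_big /=; apply: eq_bigr => j _.
rewrite (reindex_inj (addIr j)) /=; apply: eq_bigr => l _.
by rewrite addrK wpowD invfM -scalemxAl -scalemxAr scalerA.
Qed.

Lemma tft_herm n m (X : tensor C n m p.+1) i :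
  tft (therm X) i = map_mx Num.conj (tft X i)^T.
Proof.
rewrite !ffunE !raddf_sum /= (reindex_inj (@oppr_inj _)) /=.
apply: eq_bigr => k _; rewrite ffunE opprK wpowN invrK.
by apply/matrixP => a b; rewrite !mxE rmorphM /= -conj_wpow conjCK.
Qed.

Lemma tft_e1 i : tft (tube_e1 : tensor C 1 1 p.+1) i = 1%:M.
Proof.
rewrite ffunE (bigD1 0) //= big1 ?addr0 => [|k k0].
  by rewrite ffunE mxE !eqxx muln0 invr1 scale1r.
by rewrite ffunE mxE (negbTE k0) raddf0 scaler0.
Qed.

End TensorFourier.

(** * Invertibility and order in Fourier coordinates *)

Section TensorFourierOrder.
Context {C : numClosedFieldType} {p : nat} (w : C).
Hypothesis w_prim : (p.+1).-primitive_root w.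

Lemma inj_unitmx n (M : 'M[C]_n) :
  (forall v : 'cV_n, M *m v = 0 -> v = 0) -> M \in unitmx.
Proof.
move=> M_inj; rewrite -unitmx_tr -row_free_unit; apply: inj_row_free => v.
rewrite -[v in X in X -> _]trmxK -trmx_mul => /(congr1 trmx).
by rewrite trmxK trmx0 => /M_inj /(congr1 trmx); rewrite trmxK trmx0.
Qed.

Lemma tnonsingularP n (A : tensor C n n p.+1) :
  tnonsingular A <-> forall i, tft w A i \in unitmx.
Proof.
split=> [A_ns i|A_ns].
  apply: inj_unitmx => v Av0.
  (* A kernel vector of one slice gives a kernel tensor of A, supported on
     that single frequency. *)
  pose V : tensor C n 1 p.+1 := itft w [ffun j => v *+ (j == i)].
  have AV0 : tmul A V = 0.
    apply: (tft_inj w_prim); apply/ffunP => j.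
    rewrite (tft_mul w_prim) (itftK w_prim) tft0 [X in _ *m X]ffunE.
    by have [->|_] := eqVneq j i; rewrite ?mulmx0.
  have bV0 : bcirc A *m tunfold V = 0.
    rewrite -[LHS]submxcolK -[RHS]submxcolK; apply: eq_mxcol => j.
    have /ffunP/(_ j) := AV0; rewrite !ffunE => ->.
    by apply/matrixP => a b; rewrite !mxE.
  have V0 : V = 0.
    apply/ffunP => j; rewrite -(mxcolK V j) -/(tunfold V).
    rewrite -(mulKmx A_ns (tunfold V)) bV0 mulmx0 ffunE.
    by apply/matrixP => a b; rewrite !mxE.
  have := congr1 (fun T : tensor C n 1 p.+1 => tft w T i) V0.
  by rewrite (itftK w_prim) ffunE eqxx tft0.
apply: inj_unitmx => v Av0.
pose V : tensor C n 1 p.+1 := tfold v.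
have vE : tunfold V = v.
  by rewrite -[RHS]submxcolK; apply: eq_mxcol => k; rewrite ffunE.
have AV0 : tmul A V = 0.
  apply/ffunP => j; rewrite /tmul vE Av0 !ffunE.
  by apply/matrixP => a b; rewrite !mxE.
have V0 : V = 0.
  apply: (tft_inj w_prim); apply/ffunP => i.
  rewrite -[LHS](mulKmx (A_ns i)) -(tft_mul w_prim) AV0.
  by rewrite !tft0 mulmx0.
rewrite -vE V0 -[RHS]submxcolK; apply: eq_mxcol => k; rewrite ffunE.
by apply/matrixP => a b; rewrite !mxE.
Qed.

(** The i-th Fourier coefficient of a tubular tensor, as a scalar: an
    eigenvalue of [circ a] when w = [dft_root]. *)
Definition ttft (a : tensor C 1 1 p.+1) i : C := tft w a i 0 0.

Lemma ttft_inj a b : (forall i, ttft a i = ttft b i) -> a = b.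
Proof.
move=> ab; apply: (tft_inj w_prim); apply/ffunP => i.
by rewrite [LHS]mx11_scalar [RHS]mx11_scalar -!/(ttft _ i) ab.
Qed.

Lemma ttftB a b i : ttft (a - b) i = ttft a i - ttft b i.
Proof. by rewrite /ttft tftB !mxE. Qed.

Lemma ttftD a b i : ttft (a + b) i = ttft a i + ttft b i.
Proof. by rewrite /ttft tftD !mxE. Qed.

Lemma ttft_mul a b i : ttft (tmul a b) i = ttft a i * ttft b i.
Proof. by rewrite /ttft (tft_mul w_prim) mxE big_ord1. Qed.

Lemma ttft_e1 i : ttft tube_e1 i = 1.
Proof. by rewrite /ttft tft_e1 mxE. Qed.

Lemma ttft_herm a i : ttft (therm a) i = (ttft a i)^*.
Proof. by rewrite /ttft (tft_herm w_prim) !mxE. Qed.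

Lemma ttft_nonsingularP a : tnonsingular a <-> forall i, ttft a i != 0.
Proof.
rewrite tnonsingularP; split=> a_ns i; have := a_ns i;
  by rewrite unitmxE det_mx11 unitfE.
Qed.

Lemma ttft_inv a i : tnonsingular a -> ttft (tinv a) i = (ttft a i)^-1.
Proof.
move=> a_ns; have a0 : ttft a i != 0 by move/ttft_nonsingularP: a_ns.
by apply: (mulfI a0); rewrite -ttft_mul tmul_tinv // ttft_e1 divff.
Qed.

Lemma ttft_dot n (X Y : tensor C n 1 p.+1) i :
  ttft (tdot X Y) i = \sum_j (tft w X i j 0)^* * tft w Y i j 0.
Proof.
rewrite /ttft /tdot (tft_mul w_prim) (tft_herm w_prim) mxE.
by apply: eq_bigr => j _; rewrite !mxE.
Qed.

Lemma thermitian_tube (a : tensor C 1 1 p.+1) :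
  (forall i, ttft a i \is Num.real) -> thermitian a.
Proof. by move=> ar; apply: ttft_inj => i; rewrite ttft_herm conj_Creal. Qed.

Lemma tpsd_tube (a : tensor C 1 1 p.+1) :
  (forall i, 0 <= ttft a i) -> tpsd a.
Proof.
move=> a_ge0 X _; set T := tmul _ X.
(* The first slice of T is the mean of its Fourier coefficients. *)
rewrite -(tftK w_prim T) ffunE mxE mulr_ge0 ?invr_ge0 ?ler0n //.
rewrite summxE sumr_ge0 // => i _; rewrite mxE muln0 mul1r -/(ttft T i).
by rewrite /T !ttft_mul ttft_herm mulrAC -normCKC mulr_ge0 ?exprn_ge0.
Qed.

Lemma tle_tube (a b : tensor C 1 1 p.+1) :
  (forall i, ttft a i \is Num.real) -> (forall i, ttft b i \is Num.real) ->
  (forall i, ttft a i <= ttft b i) -> tle a b.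
Proof.
move=> ar br ab; split; [exact: thermitian_tube|exact: thermitian_tube|].
by apply: tpsd_tube => i; rewrite ttftB subr_ge0.
Qed.

End TensorFourierOrder.

(** * Block-diagonalisation by the DFT matrix and tubular eigenvalues *)

Section DFT.
Context {R : realType} {p : nat}.
Local Open Scope complex_scope.

Local Notation w := (@dft_root R p).

Lemma cisX (x : R) k : (cos x -i* sin x) ^+ k = cos (x *+ k) -i* sin (x *+ k).
Proof.
elim: k => [|k IHk]; first by rewrite expr0 mulr0n cos0 sin0 oppr0.
rewrite exprS IHk mulrS cosD sinD; apply/eqP; rewrite eq_complex /=.
by apply/andP; split; apply/eqP; ring.
Qed.

Lemma cos_lt1 (x : R) : 0 < x < 2 * pi -> cos x < 1.
Proof.
(* cos x = 1 - 2 sin (x / 2) ^ 2, with 0 < x / 2 < pi *)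
move=> /andP[x0 x2pi]; rewrite -[x](divfK (_ : 2 != 0)) ?pnatr_eq0 // mulr_natr.
rewrite cos_mulr2n cos2sin2.
have s0 : 0 < sin (x / 2).
  by apply: sin_gt0_pi; rewrite divr_gt0 //= ltr_pdivrMr // mulrC.
have : 0 < sin (x / 2) ^+ 2 by rewrite exprn_gt0.
by move=> ?; lra.
Qed.

Lemma dft_root_prim : (p.+1).-primitive_root w.
Proof.
have N0 : p.+1%:R != 0 :> R by rewrite pnatr_eq0.
apply/andP; split=> //; apply/forallP => i; apply/eqP.
rewrite unity_rootE /dft_root cisX -[_ *+ i.+1]mulr_natr.
have [->|ip] := eqVneq i.+1 p.+1.
  rewrite divfK // mulr_natl cos2pi sin2pi oppr0.
  exact/eqP.
apply/negbTE; rewrite eq_complex negb_and /=; apply/orP; left.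
rewrite lt_eqF // cos_lt1 // -mulrA mulr_gt0 ?mulr_gt0 ?invr_gt0 ?pi_gt0 ?ltr0n //=.
rewrite gtr_pMr ?mulr_gt0 ?pi_gt0 // mulrC ltr_pdivrMr ?ltr0n // mul1r ltr_nat.
by rewrite ltn_neqAle ip ltn_ord.
Qed.

Lemma dftE (i j : 'I_p.+1) : dft i j = (Num.sqrt p.+1%:R)^-1%:C * w ^+ (i * j).
Proof. by rewrite mxE. Qed.

Lemma dftHE (i j : 'I_p.+1) : dftH i j = (Num.sqrt p.+1%:R)^-1%:C * w ^- (j * i).
Proof.
rewrite !mxE rmorphM /= (conj_wpow dft_root_prim); congr (_ * _).
by apply: conj_Creal; apply/complex_realP; eexists.
Qed.

Lemma dft_scale : (Num.sqrt p.+1%:R)^-1%:C * (Num.sqrt p.+1%:R)^-1%:C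
  = (p.+1%:R)^-1 :> R[i].
Proof.
by rewrite -rmorphM -invfM -expr2 sqr_sqrtr ?ler0n // fmorphV rmorph_nat.
Qed.

Lemma kron_mxdiagE n (D : {ffun 'I_p.+1 -> 'M[R[i]]_n}) :
  kronI n dft *m (\mxdiag_(i < p.+1) D i) *m kronI n dftH = bcirc (itft w D).
Proof.
rewrite /kronI mul_mxblock_mxdiag mul_mxblock; apply: eq_mxblock => i j.
rewrite ffunE scaler_sumr; apply: eq_bigr => l _.
rewrite dftE dftHE mul_scalar_mx mul_mx_scalar !scalerA; congr (_ *: _).
by rewrite (wpowB dft_root_prim) -dft_scale [(i * l)%N]mulnC [(j * l)%N]mulnC; ring.
Qed.

Lemma bcirc_inj n m : injective (@bcirc R[i] p n m).
Proof.
move=> X Y XY; apply/ffunP => k.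
have {}XY := iffRL (eq_mxblockP (fun i j => X (i - j)) (fun i j => Y (i - j))) XY.
by have := XY k 0; rewrite subr0.
Qed.

Lemma dft_blocksE n (H : tensor R[i] n n p.+1) : dft_blocks H = tft w H.
Proof.
rewrite /dft_blocks; apply: xget_unique => /=.
  by rewrite kron_mxdiagE (tftK dft_root_prim).
move=> D; rewrite kron_mxdiagE => /bcirc_inj ->.
by rewrite (itftK dft_root_prim).
Qed.

Lemma circ_dftE (a : tensor R[i] 1 1 p.+1) :
  dftH *m circ a *m dft = diag_mx (\row_i ttft w a i).
Proof.
apply/matrixP => i j; rewrite !mxE.
(* Substituting k + l for the summation index k separates a k from the
   sum over l, to which orthogonality applies. *)
under eq_bigr => l _.
  rewrite mxE mulr_suml (reindex_inj (addIr l)) /=.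
  under eq_bigr => k _.
    rewrite dftE dftHE mxE addrK.
    rewrite [((k + l)%R * i)%N]mulnC (wpowD dft_root_prim).
    rewrite (_ : _ * _ * _ = w ^- (i * k) * a k 0 0 *
        ((p.+1%:R)^-1 * (w ^+ (l * j) / w ^+ (l * i)))); last first.
      by rewrite -dft_scale invfM [(i * l)%N]mulnC; ring.
    over.
  over.
rewrite exchange_big /=.
under eq_bigr do rewrite -mulr_sumr -mulr_sumr (wpow_orth dft_root_prim).
rewrite -mulr_suml mulrnAr mulVf ?pnatr_eq0 // mulr_natr [j == i]eq_sym.
congr (_ *+ _); rewrite /ttft ffunE summxE.
by apply: eq_bigr => k _; rewrite mxE.
Qed.

(** The common form of [tlambda_min] and [tlambda_max]: the tubular tensor
    whose Fourier coefficients are f of the diagonal blocks exists and is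
    unique, so the default value of [xget] plays no role. *)
Lemma tlambdaE n (H : tensor R[i] n n p.+1) (f : 'M[R[i]]_n -> R[i]) i :
  ttft w (xget 0 [set l : tensor R[i] 1 1 p.+1 | dftH *m circ l *m dft
    = diag_mx (\row_(i < p.+1) f (dft_blocks H i))]%classic) i = f (tft w H i).
Proof.
case: xgetP => [l _ /=|/(_ (itft w [ffun i => (f (tft w H i))%:M]))[]] /=.
  by rewrite circ_dftE dft_blocksE => /matrixP/(_ i i); rewrite !mxE eqxx.
rewrite circ_dftE dft_blocksE; congr diag_mx; apply/rowP => j; rewrite !mxE.
by rewrite /ttft (itftK dft_root_prim) ffunE mxE eqxx.
Qed.

Lemma ttft_lambda_min n (H : tensor R[i] n n p.+1) i :
  ttft w (tlambda_min H) i = lambda_min (tft w H i).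
Proof. exact: tlambdaE. Qed.

Lemma ttft_lambda_max n (H : tensor R[i] n n p.+1) i :
  ttft w (tlambda_max H) i = lambda_max (tft w H i).
Proof. exact: tlambdaE. Qed.

End DFT.

(** * Steepest descent for one positive definite matrix *)

Section Block.
Context {C : numClosedFieldType}.

(** The Kantorovich inequality for finite sums with nonnegative weights u. *)
Lemma kantorovich_sum (I : finType) (s u : I -> C) (l L : C) :
  0 <= l -> l <= L -> (forall i, 0 <= u i) -> (forall i, l <= s i <= L) ->
  4 * l * L * (\sum_i u i) * (\sum_i s i ^+ 2 * u i)
    <= (l + L) ^+ 2 * (\sum_i s i * u i) ^+ 2.
Proof.
move=> l0 lL u0 lsL.
have L0 : 0 <= L := le_trans l0 lL.
have s0 i : 0 <= s i by have /andP[/(le_trans l0)] := lsL i.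
set S0 := \sum_i u i; set S1 := \sum_i s i * u i; set S2 := \sum_i _ * u i.
have S0_ge0 : 0 <= S0 by apply: sumr_ge0.
have S2_ge0 : 0 <= S2.
  by apply: sumr_ge0 => i _; rewrite mulr_ge0 ?exprn_ge0.
(* The difference is the sum of the (s i - l) (L - s i) u i. *)
have c_ge0 : 0 <= (l + L) * S1 - (S2 + l * L * S0).
  rewrite /S0 /S1 /S2 !mulr_sumr -big_split -sumrB /=.
  apply: sumr_ge0 => i _; have /andP[lsi sLi] := lsL i.
  rewrite (_ : _ - _ = (s i - l) * (L - s i) * u i); last by ring.
  by rewrite !mulr_ge0 ?subr_ge0.
(* 4 x y <= (x + y) ^ 2 for x = S2 and y = l L S0 *)
apply: (@le_trans _ _ ((S2 + l * L * S0) ^+ 2)).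
  rewrite -subr_ge0 (_ : _ - _ = (S2 - l * L * S0) ^+ 2); last by ring.
  by rewrite -realEsqr rpredB ?ger0_real ?mulr_ge0.
rewrite -exprMn lerXn2r // ?nnegrE ?addr_ge0 ?mulr_ge0 ?addr_ge0 //.
  by apply: sumr_ge0 => i _; rewrite mulr_ge0.
by rewrite -subr_ge0.
Qed.

Lemma eigenvalue_similar_diag n (M U : 'M[C]_n) (s : 'rV_n) a :
  U \in unitmx -> M = invmx U *m diag_mx s *m U ->
  eigenvalue M a <-> exists i, a = s 0 i.
Proof.
move=> U_unit ME; split=> [/eigenvalueP[v vM v0]|[i ->]].
  have : v *m invmx U != 0.
    by apply: contra v0 => /eqP vU; rewrite -(mulmxKV U_unit v) vU mul0mx.
  case/rV0Pn => i vi; exists i; apply: (mulIf vi).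
  have : v *m invmx U *m diag_mx s = a *: (v *m invmx U).
    by rewrite scalemxAl -vM ME -!mulmxA mulmxV // mulmx1.
  by move/rowP/(_ i); rewrite mul_mx_diag !mxE mulrC => <-; rewrite mulrC.
apply/eigenvalueP; exists (row i U).
  rewrite ME !mulmxA -row_mul mulmxV // row1 -rowE row_diag_mx.
  by rewrite -scalemxAl -rowE.
apply: contraTneq U_unit => Ui0.
rewrite unitmxE (expand_det_row _ i) big1 ?unitr0 // => j _.
by have /rowP/(_ j) := Ui0; rewrite !mxE => ->; rewrite mul0r.
Qed.

Lemma lambda_min_similar_diag n (M U : 'M[C]_n) (s : 'rV_n) : (0 < n)%N ->
  U \in unitmx -> M = invmx U *m diag_mx s *m U ->
  (forall i, s 0 i \is Num.real) ->
  (exists i, lambda_min M = s 0 i) /\ forall i, lambda_min M <= s 0 i.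
Proof.
case: n => // n in M U s * => _ U_unit ME s_real.
have eigM := eigenvalue_similar_diag _ U_unit ME.
rewrite /lambda_min; case: xgetP => [l _ [/eigM ll lmin]|] /=.
  by split=> // i; apply: lmin; apply/eigM; exists i.
have [|i _ imin] := @real_arg_minP _ _ ord0 xpredT (s 0) isT.
  by move=> i _; exact: s_real.
move=> /(_ (s 0 i))[]; split; first by apply/eigM; exists i.
by move=> _ /eigM[j ->]; exact: imin.
Qed.

Lemma lambda_max_similar_diag n (M U : 'M[C]_n) (s : 'rV_n) : (0 < n)%N ->
  U \in unitmx -> M = invmx U *m diag_mx s *m U ->
  (forall i, s 0 i \is Num.real) ->
  forall i, s 0 i <= lambda_max M.
Proof.
case: n => // n in M U s * => _ U_unit ME s_real.
have eigM := eigenvalue_similar_diag _ U_unit ME.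
rewrite /lambda_max; case: xgetP => [l _ [_ lmax]|] /=.
  by move=> i; apply: lmax; apply/eigM; exists i.
have [|i _ imax] := @real_arg_maxP _ _ ord0 xpredT (s 0) isT.
  by move=> i _; exact: s_real.
move=> /(_ (s 0 i))[]; split; first by apply/eigM; exists i.
by move=> _ /eigM[j ->]; exact: imax.
Qed.

(** The squared Hermitian norm of a column vector. *)
Definition sqn n (v : 'cV[C]_n) : C := \sum_j `|v j 0| ^+ 2.

Lemma sqnE n (v : 'cV[C]_n) : sqn v = (map_mx Num.conj v^T *m v) 0 0.
Proof. by rewrite mxE; apply: eq_bigr => j _; rewrite !mxE normCKC. Qed.

Lemma sqn_eq0 n (v : 'cV[C]_n) : sqn v = 0 -> v = 0.
Proof.
move/eqP; rewrite psumr_eq0 => [/allP v0|i _]; last by rewrite exprn_ge0.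
apply/colP => i; have := v0 i (mem_index_enum _).
by rewrite expf_eq0 normr_eq0 mxE => /eqP.
Qed.

(** Spectral theorem for P^H P: U maps a vector to its coordinates in an
    orthonormal eigenbasis, and s lists the eigenvalues. *)
Lemma gram_spectral n (P : 'M[C]_n) :
  exists U : 'M[C]_n, exists s : 'rV[C]_n,
  [/\ U \in unitmx, map_mx Num.conj P^T *m P = invmx U *m diag_mx s *m U,
   forall i, s 0 i \is Num.real, forall v : 'cV_n, sqn (U *m v) = sqn v &
   forall v : 'cV_n, sqn (P *m v) = \sum_i s 0 i * `|(U *m v) i 0| ^+ 2].
Proof.
set M := map_mx _ _ *m P.
have M_herm : M \is hermsymmx.
  apply/is_hermitianmxP; rewrite expr0 scale1r /M trmx_mul map_mxM.
  by rewrite map_trmx trmxK -map_mx_comp (map_mx_id (@conjCK _)).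
pose U := spectralmx M; have U_unitary : U \is unitarymx := spectral_unitarymx M.
have ME := orthomx_spectralP (hermitian_normalmx M_herm).
exists U, (spectral_diag M); split=> //.
- exact: unitarymx_unit.
- by move=> i; have /mxOverP := hermitian_spectral_diag_real M_herm; apply.
- move=> v; rewrite !sqnE trmx_mul map_mxM -mulmxA.
  rewrite -(invmx_unitary U_unitary) mulKmx //.
  exact: unitarymx_unit.
move=> v; rewrite sqnE trmx_mul map_mxM -mulmxA (mulmxA _ P) -/M [in LHS]ME.
rewrite -/U invmx_unitary //.
rewrite !mulmxA -map_mxM -trmx_mul -mulmxA mul_mx_diag mxE.
by apply: eq_bigr => i _; rewrite !mxE normCK; ring.
Qed.

Lemma gram_lambda n (P : 'M[C]_n) (M := map_mx Num.conj P^T *m P) :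
  (0 < n)%N -> P \in unitmx -> 0 < lambda_min M <= lambda_max M.
Proof.
move=> n0 P_unit; have [U [s [U_unit ME s_real _ qE]]] := gram_spectral P.
have [[i li] _] := lambda_min_similar_diag n0 U_unit ME s_real.
rewrite /M li (lambda_max_similar_diag n0 U_unit ME s_real) andbT.
(* an eigenvector for the least eigenvalue *)
pose v : 'cV_n := invmx U *m delta_mx i 0.
have -> : s 0 i = sqn (P *m v).
  rewrite qE /v mulKVmx // (bigD1 i) //= big1 => [|j ji].
    by rewrite mxE !eqxx normr1 expr1n mulr1 addr0.
  by rewrite mxE (negbTE ji) normr0 expr0n mulr0.
rewrite lt_def sumr_ge0 ?andbT => [|j _]; last by rewrite exprn_ge0.
apply/eqP => /sqn_eq0 /(congr1 (mulmx (invmx P))); rewrite mulKmx // mulmx0.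
move=> /(congr1 (mulmx U)); rewrite mulKVmx // mulmx0 => /colP/(_ i).
by rewrite !mxE !eqxx => /eqP; rewrite oner_eq0.
Qed.

(** Contraction of the energy |P e|^2 in one steepest descent step.  The step
    |d|^2 / |P d|^2 is the exact line search along d = M e, and k is the
    condition number of M = P^H P. *)
Lemma sd_contraction n (P : 'M[C]_n) (e : 'cV[C]_n)
    (M := map_mx Num.conj P^T *m P) (d := M *m e)
    (e' := e - (sqn d / sqn (P *m d)) *: d)
    (k := lambda_max M / lambda_min M) :
  (0 < n)%N -> P \in unitmx -> sqn (P *m d) != 0 ->
  sqn (P *m e') <= (k - 1) ^+ 2 * (k + 1) ^- 2 * sqn (P *m e).
Proof.
move=> n0 P_unit b0; have [U [s [U_unit ME s_real nU qE]]] := gram_spectral P.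
have [_ lmin] := lambda_min_similar_diag n0 U_unit ME s_real.
have lmax := lambda_max_similar_diag n0 U_unit ME s_real.
have /andP[l0 lL] := gram_lambda n0 P_unit.
rewrite -/M in ME lmin lmax l0 lL.
have L0 := lt_le_trans l0 lL.
set y := U *m e; set t := sqn d / _ in e' *.
have UdE i : (U *m d) i 0 = s 0 i * y i 0.
  by rewrite /d ME !mulmxA mulmxV // mul1mx -mulmxA mul_diag_mx mxE.
have s_ge0 i : 0 <= s 0 i := le_trans (ltW l0) (lmin i).
have normsy i : `|s 0 i * y i 0| ^+ 2 = s 0 i ^+ 2 * `|y i 0| ^+ 2.
  by rewrite normrM ger0_norm // exprMn.
pose u i := s 0 i * `|y i 0| ^+ 2.
have aE : sqn d = \sum_i s 0 i * u i.
  by rewrite -nU; apply: eq_bigr => i _; rewrite UdE normsy /u; ring.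
have bE : sqn (P *m d) = \sum_i s 0 i ^+ 2 * u i.
  by rewrite qE; apply: eq_bigr => i _; rewrite UdE normsy /u; ring.
have qeE : sqn (P *m e) = \sum_i u i by rewrite qE.
have t_real : t \is Num.real.
  by rewrite ger0_real // divr_ge0 // sumr_ge0 // => i _; rewrite exprn_ge0.
have q'E : sqn (P *m e') = sqn (P *m e) - sqn d ^+ 2 / sqn (P *m d).
  (* The coordinates of e' are (1 - t s_i) y_i; expand the square. *)
  transitivity (\sum_i u i - (2 * t * \sum_i s 0 i * u i)
      + t ^+ 2 * \sum_i s 0 i ^+ 2 * u i).
    rewrite qE !mulr_sumr -sumrB -big_split /=; apply: eq_bigr => i _.
    rewrite /e' mulmxBr -scalemxAr mxE [X in _ + X]mxE [X in _ - X]mxE UdE -/y.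
    rewrite (_ : _ - _ = (1 - t * s 0 i) * y i 0); last by ring.
    rewrite normrM exprMn real_normK; last first.
      by rewrite realB ?rpred1 // realM.
    by rewrite /u; ring.
  by rewrite -qeE -aE -bE /t; field.
have b_gt0 : 0 < sqn (P *m d).
  by rewrite lt_def b0 sumr_ge0 // => i _; rewrite exprn_ge0.
have u_ge0 i : 0 <= u i by rewrite mulr_ge0 ?exprn_ge0.
have lsL i : lambda_min M <= s 0 i <= lambda_max M by rewrite lmin lmax.
have := kantorovich_sum (ltW l0) lL u_ge0 lsL.
rewrite -aE -bE -qeE q'E -subr_ge0 => kant; rewrite -subr_ge0.
set l := lambda_min M in k l0 lL kant *; set L := lambda_max M in k lL L0 kant *.
set q := sqn (P *m e) in kant *; set a := sqn d in kant *.
set b := sqn (P *m d) in b0 b_gt0 kant *.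
have lL_gt0 : 0 < l + L by apply: addr_gt0.
rewrite (_ : _ - _ = ((l + L) ^+ 2 * a ^+ 2 - 4 * l * L * q * b)
    / ((l + L) ^+ 2 * b)).
  by rewrite mulr_ge0 // invr_ge0 mulr_ge0 ?exprn_ge0 ?ltW.
rewrite /k; field.
by rewrite !gt_eqF.
Qed.

End Block.

(** * Tubular steepest descent *)

Section TensorSteepestDescent.
Context {C : numClosedFieldType} {p : nat} (w : C).
Hypothesis w_prim : (p.+1).-primitive_root w.

Lemma ttr_real n m (X : tensor C n m p.+1) : treal X -> ttr X = therm X.
Proof.
move=> X_real; apply/ffunP => k; rewrite !ffunE; apply/matrixP => i j.
by rewrite !mxE conj_Creal //; have /mxOverP := X_real (- k); apply.
Qed.

Lemma ttft_norm2 n (X : tensor C n 1 p.+1) i : ttft w (tnorm2 X) i = sqn (tft w X i).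
Proof. by rewrite (ttft_dot w_prim); apply: eq_bigr => j _; rewrite -normCKC. Qed.

Lemma tft_tube a i : tft w (a : tensor C 1 1 p.+1) i = (ttft w a i)%:M.
Proof. exact: mx11_scalar. Qed.

Lemma tft_gram n (A : tensor C n n p.+1) i :
  tft w (tmul (therm A) A) i = map_mx Num.conj (tft w A i)^T *m tft w A i.
Proof. by rewrite (tft_mul w_prim) (tft_herm w_prim). Qed.

(** The descent direction is A^H A (Xs - X), read slice by slice. *)
Lemma tft_sd_dir n (A : tensor C n n p.+1) (B Xs X : tensor C n 1 p.+1) i :
  ttr A = therm A -> tmul (tmul (ttr A) A) Xs = tmul (ttr A) B ->
  tft w (sd_dir A B X) i = tft w (tmul (therm A) A) i *m tft w (Xs - X) i.
Proof.
move=> trA Xs_sol; have /ffunP/(_ i) := congr1 (@tft C p w n 1) Xs_sol.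
rewrite /sd_dir trA !(tft_mul w_prim) => solE.
by rewrite !tftB (tft_mul w_prim) !mulmxBr -solE !mulmxA.
Qed.

Lemma tft_sd_step n (A : tensor C n n p.+1) (B X : tensor C n 1 p.+1) i
    (D := sd_dir A B X) :
  tnonsingular (tnorm2 (tmul A D)) ->
  tft w (sd_step A B X) i = tft w X i
    + (sqn (tft w D i) / sqn (tft w A i *m tft w D i)) *: tft w D i.
Proof.
move=> D_ns; rewrite /sd_step tftD -/D; congr (_ + _).
rewrite (tft_mul w_prim (tmul D _)) (tft_mul w_prim D) !tft_tube.
rewrite (ttft_inv w_prim) // !ttft_norm2 (tft_mul w_prim).
by rewrite !mul_mx_scalar scalerA mulrC.
Qed.

(** The energy estimate for a single step from an arbitrary X, with lmin and
    lmax any tubular tensors whose Fourier coefficients are the extreme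
    eigenvalues of the slices. *)
Lemma sd_step_energy n (A : tensor C n n p.+1) (B Xs X : tensor C n 1 p.+1)
    (lmin lmax : tensor C 1 1 p.+1) :
  (0 < n)%N -> ttr A = therm A -> tnonsingular A ->
  tmul (tmul (ttr A) A) Xs = tmul (ttr A) B ->
  tnonsingular (tnorm2 (tmul A (sd_dir A B X))) ->
  (forall i, ttft w lmin i = lambda_min (tft w (tmul (ttr A) A) i)) ->
  (forall i, ttft w lmax i = lambda_max (tft w (tmul (ttr A) A) i)) ->
  let energy Y := tnorm2 (tmul A (Xs - Y)) in
  let kappa := tmul lmax (tinv lmin) in
  let a := kappa - tube_e1 in
  let b := tinv (kappa + tube_e1) in
  tle (energy (sd_step A B X)) (tmul (tmul (tmul a a) (tmul b b)) (energy X)).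
Proof.
move=> n0 trA A_ns Xs_sol D_ns lminE lmaxE energy kappa a b.
pose M i := map_mx Num.conj (tft w A i)^T *m tft w A i.
have A_unit i : tft w A i \in unitmx.
  exact: (iffLR (tnonsingularP w_prim A) A_ns i).
have lam i : 0 < lambda_min (M i) <= lambda_max (M i) by exact: gram_lambda.
have ME i : tft w (tmul (ttr A) A) i = M i by rewrite trA tft_gram.
have lmin_ns : tnonsingular lmin.
  apply/(ttft_nonsingularP w_prim) => i; rewrite lminE ME.
  by have /andP[/gt_eqF ->] := lam i.
have kappaE i : ttft w kappa i = lambda_max (M i) / lambda_min (M i).
  by rewrite (ttft_mul w_prim) (ttft_inv w_prim) // lminE lmaxE ME.
have kappa_ge0 i : 0 <= ttft w kappa i.
  have /andP[l0 lL] := lam i.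
  by rewrite kappaE divr_ge0 ?ltW // (lt_le_trans l0 lL).
have kappa1_ns : tnonsingular (kappa + tube_e1).
  apply/(ttft_nonsingularP w_prim) => i; rewrite ttftD ttft_e1.
  by rewrite gt_eqF // ltr_wpDl.
have rateE i : ttft w (tmul (tmul a a) (tmul b b)) i =
    (ttft w kappa i - 1) ^+ 2 * (ttft w kappa i + 1) ^- 2.
  rewrite (ttft_mul w_prim (tmul a a)) (ttft_mul w_prim a) (ttft_mul w_prim b).
  rewrite (ttft_inv w_prim) // ttftB ttftD ttft_e1.
  by rewrite -!expr2 exprVn.
have energyE Y i : ttft w (energy Y) i = sqn (tft w A i *m tft w (Xs - Y) i).
  by rewrite ttft_norm2 (tft_mul w_prim).
have DE i : tft w (sd_dir A B X) i = M i *m tft w (Xs - X) i.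
  by rewrite (tft_sd_dir _ _ trA Xs_sol) tft_gram.
have sqn_real m (v : 'cV[C]_m) : sqn v \is Num.real.
  by rewrite ger0_real // sumr_ge0 // => i _; rewrite exprn_ge0.
have k_real i : ttft w kappa i \is Num.real by rewrite ger0_real.
apply: (tle_tube w_prim) => i.
- by rewrite energyE.
- rewrite (ttft_mul w_prim) rateE energyE realM // realM ?realV ?realX //.
    by rewrite realB ?rpred1.
  by rewrite realD ?rpred1.
rewrite (ttft_mul w_prim) rateE !energyE kappaE.
rewrite tftB tft_sd_step // opprD addrA -tftB DE; apply: sd_contraction => //.
rewrite -DE -(tft_mul w_prim) -ttft_norm2.
exact: (iffLR (ttft_nonsingularP w_prim _) D_ns).
Qed.

End TensorSteepestDescent.

Local Open Scope complex_scope.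

Theorem theorem3p11 (R : realType) (n p : nat) (hn : (0 < n)%N)
    (A : tensor R[i] n n p.+1) (B Xstar : tensor R[i] n 1 p.+1)
    (X : nat -> tensor R[i] n 1 p.+1)
    (A_real : treal A) (A_ns : tnonsingular A) (B_real : treal B)
    (Xstar_sol : tmul (tmul (ttr A) A) Xstar = tmul (ttr A) B)
    (X0_real : treal (X 0%N)) (k : nat)
    (iter_defined : forall j, (j <= k)%N ->
       tnonsingular (tnorm2 (tmul A (sd_dir A B (X j)))))
    (iter_step : forall j, (j <= k)%N -> X j.+1 = sd_step A B (X j)) :
  let E j := Xstar - X j in
  let kappa := tkappa (tmul (ttr A) A) in
  tle (tdot (tmul A (E k.+1)) (tmul A (E k.+1)))
      (tmul (sd_rate kappa) (tdot (tmul A (E k)) (tmul A (E k)))).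
Proof.
move=> E kappa; rewrite /E (iter_step k (leqnn k)).
apply: (sd_step_energy dft_root_prim hn (ttr_real A_real) A_ns Xstar_sol
  (iter_defined k (leqnn k))).
- exact: ttft_lambda_min.
- exact: ttft_lambda_max.
Qed.
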